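(* Let $\mathcal{H}$ be a finite-dimensional Hilbert space and let the set of free states be $\mathcal{F}(\mathcal{H})=\bigcup_k\mathcal{F}_k(\mathcal{H})\subseteq\mathcal{D}(\mathcal{H})$, where each $\mathcal{F}_k(\mathcal{H})$ is a closed convex set and $\mathcal{F}(\mathcal{H})$ is closed. For any resource state $\rho\in\mathcal{D}(\mathcal{H})\setminus\mathcal{F}(\mathcal{H})$, \[1-\sup_k\ \min_{\{p_i,\Lambda_i\}_i,\{M_i\}_i}\frac{p_{\mathrm{err}}(\rho,\{p_i,\Lambda_i\}_i,\{M_i\}_i)}{\min_{\sigma_k\in\mathcal{F}_k(\mathcal{H})}p_{\mathrm{err}}(\sigma_k,\{p_i,\Lambda_i\}_i,\{M_i\}_i)}=\mathrm{WoR}_{\mathcal{F}(\mathcal{H})}(\rho).\]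
   Context: $\mathcal{D}(\mathcal{H})$ is the set of density operators on $\mathcal{H}$. A channel ensemble $\{p_i,\Lambda_i\}_i$ consists of a finite probability distribution $(p_i)_i$ and quantum channels $\Lambda_i$ from operators on $\mathcal{H}$ to operators on a common finite-dimensional output space; $\{M_i\}_i$ is a POVM on that output space; $p_{\mathrm{err}}(\omega,\{p_i,\Lambda_i\}_i,\{M_i\}_i)=\sum_ip_i\operatorname{tr}[M_i\Lambda_i(\omega)]$. The outer minimum is over all channel ensembles and POVMs. The weight of resource is $\mathrm{WoR}_{\mathcal{F}(\mathcal{H})}(\rho)=\min\{s\ge0:\exists\sigma\in\mathcal{F}(\mathcal{H}),\tau\in\mathcal{D}(\mathcal{H}),\ \rho=s\tau+(1-s)\sigma\}$.
   Formalization: The outer minimum over channel ensembles and POVMs is read as an infimum, since it need not be attained, and ranges only over those for which the minimum of p_err over F_k is positive, since otherwise the ratio can be 0/0. *)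

(* Defs.v *)
From HB Require Import structures.
From mathcomp Require Import all_boot all_order all_algebra.
From mathcomp Require Import complex.
From mathcomp Require Import all_classical all_reals all_analysis.
Set Implicit Arguments. Unset Strict Implicit. Unset Printing Implicit Defensive.
Import Order.TTheory GRing.Theory Num.Theory.
Import numFieldNormedType.Exports.
Local Open Scope ring_scope.
Local Open Scope classical_set_scope.

Section QDefs.
Variable R : realType.
Local Notation C := R[i].

Definition adjmx (m n : nat) (A : 'M[C]_(m, n)) : 'M[C]_(n, m) :=
  (map_mx (@Num.conj C) A)^T.

Definition psd (n : nat) (A : 'M[C]_n) : Prop :=
  A = adjmx A /\ forall x : 'cV[C]_n, 0 <= (adjmx x *m A *m x) 0 0.

Definition density (n : nat) : set 'M[C]_n :=
  [set rho | psd rho /\ \tr rho = 1].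

Definition blk (k n : nat) (X : 'M[C]_(k * n)) (p q : 'I_k) : 'M[C]_n :=
  \matrix_(a, b) X (mxvec_index p a) (mxvec_index q b).

Definition is_linear_map (n m : nat) (L : 'M[C]_n -> 'M[C]_m) : Prop :=
  forall (a : C) (A B : 'M[C]_n), L (a *: A + B) = a *: L A + L B.

(* complete positivity: id_k (x) L maps PSD operators to PSD operators, for every k.
   Y is the (unique) matrix whose (p,q) block is L applied to the (p,q) block of X. *)
Definition completely_positive (n m : nat) (L : 'M[C]_n -> 'M[C]_m) : Prop :=
  forall (k : nat) (X : 'M[C]_(k * n)), psd X ->
  forall Y : 'M[C]_(k * m),
    (forall (p q : 'I_k) (c d : 'I_m),
        Y (mxvec_index p c) (mxvec_index q d) = L (blk X p q) c d) ->
    psd Y.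

Definition trace_preserving (n m : nat) (L : 'M[C]_n -> 'M[C]_m) : Prop :=
  forall A : 'M[C]_n, \tr (L A) = \tr A.

Definition channel (n m : nat) (L : 'M[C]_n -> 'M[C]_m) : Prop :=
  [/\ is_linear_map L, completely_positive L & trace_preserving L].

Record ens_povm (n : nat) := EnsPovm {
  ep_N : nat;
  ep_m : nat;
  ep_p : 'I_ep_N -> R;
  ep_chan : 'I_ep_N -> 'M[C]_n -> 'M[C]_ep_m;
  ep_M : 'I_ep_N -> 'M[C]_ep_m }.
Arguments ep_N {n}. Arguments ep_m {n}.
Arguments ep_p {n} e _. Arguments ep_chan {n} e _ _. Arguments ep_M {n} e _.

Definition valid_ens_povm (n : nat) (E : ens_povm n) : Prop :=
  [/\ (forall i, 0 <= ep_p E i), \sum_i ep_p E i = 1,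
      (forall i, channel (ep_chan E i)),
      (forall i, psd (ep_M E i)) & \sum_i ep_M E i = 1%:M].

(* p_err(omega, {p_i, Lambda_i}, {M_i}) = sum_i p_i tr[M_i Lambda_i(omega)]
   (a real number; we take the real part of the complex trace expression) *)
Definition p_err (n : nat) (omega : 'M[C]_n) (E : ens_povm n) : R :=
  complex.Re (\sum_i (ep_p E i)%:C%C * \tr (ep_M E i *m ep_chan E i omega)).

Definition real_convex (n : nat) (S : set 'M[C]_n) : Prop :=
  forall A B, S A -> S B -> forall t : R, 0 <= t <= 1 ->
    S (t%:C%C *: A + (1 - t)%:C%C *: B).

Definition WoR (n : nat) (F : set 'M[C]_n) (rho : 'M[C]_n) : R :=
  inf [set s : R | 0 <= s /\ exists sigma tau,
        [/\ F sigma, density tau & rho = s%:C%C *: tau + (1 - s)%:C%C *: sigma]].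

Definition free_perr (n : nat) (Fk : set 'M[C]_n) (E : ens_povm n) : R :=
  inf [set p_err sigma E | sigma in Fk].

(* min over ensembles/POVMs (for which the ratio is defined, i.e. the
   denominator is positive) of p_err(rho,E) / min_{sigma in F_k} p_err(sigma,E) *)
Definition min_ratio (n : nat) (Fk : set 'M[C]_n) (rho : 'M[C]_n) : R :=
  inf [set r : R | exists E : ens_povm n,
        [/\ valid_ens_povm E, 0 < free_perr Fk E & r = p_err rho E / free_perr Fk E]].

End QDefs.

(* Main.v *)
Require Import Defs.
From HB Require Import structures.
From mathcomp Require Import all_boot all_order all_algebra.
From mathcomp Require Import complex spectral.
From mathcomp Require Import all_classical all_reals all_analysis.
From mathcomp Require Import ring lra.
Import Order.TTheory GRing.Theory Num.Theory.
Import numFieldNormedType.Exports.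
Set Implicit Arguments. Unset Strict Implicit.
Unset Printing Implicit Defensive.
Local Open Scope ring_scope.
Local Open Scope classical_set_scope.

(* For a single closed convex set F_k, the minimal ratio is 1 - WoR_{F_k}(rho);
   the theorem follows since the decompositions of rho over the union are those
   over the F_k, so that WoR is an infimum over k.
   If rho = s tau + (1 - s) sigma, linearity and positivity of p_err give
   p_err(rho) >= (1 - s) p_err(sigma).  Conversely, if 0 < l < 1 and rho is not
   of the form l sigma + (1 - l) tau, then rho lies outside the compact convex
   set of these mixtures and is strictly separated from it by a hermitian W.
   Density operators have trace one, so W may be shifted by a multiple of the
   identity until the infimum of tr(W tau) over all states tau is 0: then W is
   psd and tr(W rho) < l tr(W sigma) uniformly in sigma.  After rescaling to
   W <= 1, W is the effect whose expectation is p_err for the measurement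
   {W, 1 - W} and an ensemble concentrated on the first index, so the minimal
   ratio is at most l. *)

(** * Positive semidefinite matrices and the trace pairing *)

Section Psd.
Variable R : realType.
Local Notation C := R[i].

Lemma complexRe_conj (z : C) : complex.Re (Num.conj z) = complex.Re z.
Proof. by case: z. Qed.

Lemma complexIm_conj (z : C) : complex.Im (Num.conj z) = - complex.Im z.
Proof. by case: z. Qed.

Lemma complex_ge0 (z : C) :
  Num.conj z = z -> 0 <= complex.Re z -> 0 <= z.
Proof.
move=> /(congr1 (@complex.Im R)); rewrite complexIm_conj lecE /= => zr ->.
rewrite andbT; apply/eqP; lra.
Qed.

Lemma adjmxE m n (A : 'M[C]_(m, n)) i j : adjmx A i j = Num.conj (A j i).
Proof. by rewrite !mxE. Qed.

Lemma adjmxK m n (A : 'M[C]_(m, n)) : adjmx (adjmx A) = A.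
Proof. by apply/matrixP => i j; rewrite !adjmxE conjCK. Qed.

Lemma adjmx_mul m n p (A : 'M[C]_(m, n)) (B : 'M[C]_(n, p)) :
  adjmx (A *m B) = adjmx B *m adjmx A.
Proof. by rewrite /adjmx map_mxM trmx_mul. Qed.

Lemma adjmxD m n (A B : 'M[C]_(m, n)) : adjmx (A + B) = adjmx A + adjmx B.
Proof. by apply/matrixP => i j; rewrite !mxE rmorphD. Qed.

Lemma adjmxZ m n (a : C) (A : 'M[C]_(m, n)) :
  adjmx (a *: A) = Num.conj a *: adjmx A.
Proof. by apply/matrixP => i j; rewrite !mxE rmorphM. Qed.

Lemma mxtrace_adj n (A : 'M[C]_n) : \tr (adjmx A) = Num.conj (\tr A).
Proof.
by rewrite /mxtrace rmorph_sum; apply: eq_bigr => i _; rewrite adjmxE.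
Qed.

Lemma conj_realC (a : R) : Num.conj (a%:C%C : C) = a%:C%C.
Proof. exact: conjc_real. Qed.

Lemma quad_trace n (A : 'M[C]_n) (x : 'cV[C]_n) :
  (adjmx x *m A *m x) 0 0 = \tr (A *m (x *m adjmx x)).
Proof. by rewrite mulmxA mxtrace_mulC mulmxA /mxtrace big_ord1. Qed.

Lemma mxtrace_herm_real n (A B : 'M[C]_n) :
  A = adjmx A -> B = adjmx B -> Num.conj (\tr (A *m B)) = \tr (A *m B).
Proof.
by move=> hA hB; rewrite -mxtrace_adj adjmx_mul -hA -hB mxtrace_mulC.
Qed.

Lemma rank1_herm n (x : 'cV[C]_n) : x *m adjmx x = adjmx (x *m adjmx x).
Proof. by rewrite adjmx_mul adjmxK. Qed.

(** A hermitian matrix has a real quadratic form, so positivity becomes a family of real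
    inequalities, each linear in [A]. *)
Lemma psdP n (A : 'M[C]_n) :
  psd A <-> A = adjmx A /\
    forall x : 'cV[C]_n, 0 <= complex.Re (\tr (A *m (x *m adjmx x))).
Proof.
split=> -[hA qA]; split=> // x.
  by have := qA x; rewrite quad_trace lecE => /andP[_].
rewrite quad_trace; apply: complex_ge0 (qA x).
exact/mxtrace_herm_real/rank1_herm.
Qed.

(** The quadratic form at [y] is the squared modulus of the inner product of [y] and [x]. *)
Lemma psd_rank1 n (x : 'cV[C]_n) : psd (x *m adjmx x).
Proof.
apply/psdP; split=> [|y]; first exact: rank1_herm.
have -> : \tr (x *m adjmx x *m (y *m adjmx y)) =
    \tr ((adjmx y *m x) *m (adjmx x *m y)).
  by rewrite mulmxA mxtrace_mulC !mulmxA.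
rewrite [X in complex.Re X](_ : _ = `|(adjmx y *m x) 0 0| ^+ 2).
  by rewrite -add_Re2_Im2 /= addr_ge0 // sqr_ge0.
rewrite /mxtrace big_ord1 mxE big_ord1 normCK; congr (_ * _).
by rewrite -adjmxE adjmx_mul adjmxK.
Qed.

Lemma diag_conj n (X P : 'M[C]_n) i :
  (P *m X *m adjmx P) i i =
  (adjmx (col i (adjmx P)) *m X *m col i (adjmx P)) 0 0.
Proof.
have -> : adjmx (col i (adjmx P)) = row i P.
  by apply/matrixP => a b; rewrite !mxE conjCK.
by rewrite -row_mul [LHS]mxE [RHS]mxE; apply: eq_bigr => k _; rewrite !mxE.
Qed.

Lemma psd_unitary_diag n (P : 'M[C]_n) (d : 'rV[C]_n) :
  (forall i, 0 <= d 0 i) -> psd (adjmx P *m diag_mx d *m P).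
Proof.
move=> d0; have hd : adjmx (diag_mx d) = diag_mx d.
  apply/matrixP => i j; rewrite adjmxE !mxE [j == i]eq_sym.
  case: (eqVneq i j) => [->|_]; last by rewrite !mulr0n rmorph0.
  by rewrite !mulr1n conj_Creal // ger0_real.
split=> [|x]; first by rewrite !adjmx_mul adjmxK hd mulmxA.
have -> : adjmx x *m (adjmx P *m diag_mx d *m P) *m x =
    adjmx (P *m x) *m (diag_mx d *m (P *m x)).
  by rewrite adjmx_mul !mulmxA.
rewrite mxE sumr_ge0 // => i _.
by rewrite mul_diag_mx adjmxE mxE mulrCA mulr_ge0 // mulrC mul_conjC_ge0.
Qed.

(** A hermitian matrix is normal, hence unitarily diagonalizable; its eigenvalues are values of its
    quadratic form at the columns of [adjmx P]. *)
Lemma psd_spectral n (A : 'M[C]_n) : psd A ->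
  exists (P : 'M[C]_n) (d : 'rV[C]_n), [/\ P *m adjmx P = 1%:M,
    adjmx P *m P = 1%:M, forall i, 0 <= d 0 i & A = adjmx P *m diag_mx d *m P].
Proof.
move=> [hA qA].
have nA : A \is normalmx by apply/normalmxP; rewrite -map_trmx -/(adjmx A) -hA.
set P := spectralmx A; set d := spectral_diag A.
have uP : P *m adjmx P = 1%:M.
  by rewrite /adjmx map_trmx; apply/unitarymxP/spectral_unitarymx.
have eA : A = adjmx P *m diag_mx d *m P.
  rewrite /adjmx map_trmx -invmx_unitary ?spectral_unitarymx //.
  exact/orthomx_spectralP.
exists P, d; split=> // [|i]; first exact: mulmx1C.
have := qA (col i (adjmx P)); rewrite -diag_conj {1}eA.
by rewrite !mulmxA uP mul1mx -mulmxA uP mulmx1 mxE eqxx.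
Qed.

(** In an eigenbasis of [A] the trace is the sum of the eigenvalues of [A] times diagonal entries of
    [P *m B *m adjmx P], which are values of the quadratic form of [B]. *)
Lemma psd_mxtrace_mul n (A B : 'M[C]_n) : psd A -> psd B ->
  0 <= \tr (A *m B).
Proof.
move=> /psd_spectral[P [d [_ _ d0 ->]]] [hB qB].
rewrite -!mulmxA mxtrace_mulC -mulmxA /mxtrace sumr_ge0 // => i _.
by rewrite mul_diag_mx mxE mulr_ge0 // diag_conj.
Qed.

(** Each eigenvalue of the difference is the sum of the other eigenvalues of [A]. This serves both
    to bound the set of states and to rescale a witness below the identity. *)
Lemma psd_mxtrace_sub n (A : 'M[C]_n) : psd A -> psd ((\tr A)%:M - A).
Proof.
move=> /psd_spectral[P [d [uP uP' d0 ->]]].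
have -> : \tr (adjmx P *m diag_mx d *m P) = \sum_i d 0 i.
  by rewrite -mulmxA mxtrace_mulC -mulmxA uP mulmx1 mxtrace_diag.
set t := \sum_i d 0 i.
have -> : t%:M - adjmx P *m diag_mx d *m P =
    adjmx P *m diag_mx (const_mx t - d) *m P.
  rewrite linearB /= diag_const_mx mulmxBr mulmxBl mul_mx_scalar -scalemxAl uP'.
  by rewrite scalemx1.
apply: psd_unitary_diag => i.
by rewrite !mxE subr_ge0 /t (bigD1 i) //= lerDl sumr_ge0.
Qed.

Lemma psd1 n : psd (1%:M : 'M[C]_n).
Proof.
have -> : 1%:M = adjmx 1%:M *m diag_mx (const_mx 1) *m (1%:M : 'M[C]_n).
  by rewrite diag_const_mx !mulmx1 /adjmx map_mx1 trmx1.
by apply: psd_unitary_diag => i; rewrite mxE.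
Qed.

Lemma psdZ n (a : R) (A : 'M[C]_n) : 0 <= a -> psd A -> psd (a%:C%C *: A).
Proof.
move=> a0 [hA qA]; split=> [|x]; first by rewrite adjmxZ conj_realC -hA.
by rewrite -scalemxAr -scalemxAl mxE mulr_ge0 // ler0c.
Qed.

Lemma psdD n (A B : 'M[C]_n) : psd A -> psd B -> psd (A + B).
Proof.
move=> [hA qA] [hB qB]; split=> [|x]; first by rewrite adjmxD -hA -hB.
by rewrite mulmxDr mulmxDl mxE addr_ge0.
Qed.

Lemma psd_congr m n (A : 'M[C]_n) (Q : 'M[C]_(n, m)) :
  psd A -> psd (adjmx Q *m A *m Q).
Proof.
move=> [hA qA]; split=> [|x]; first by rewrite !adjmx_mul adjmxK -hA mulmxA.
by have := qA (Q *m x); rewrite adjmx_mul !mulmxA.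
Qed.

(** The submatrix is the compression of [A] by the 0-1 matrix whose columns are the basis vectors
    selected by [f]. *)
Lemma psd_mxsub m n (A : 'M[C]_n) (f : 'I_m -> 'I_n) :
  psd A -> psd (mxsub f f A).
Proof.
move=> /(psd_congr (colsub f 1%:M)); rewrite mulmx_colsub mulmx1.
have -> : adjmx (colsub f (1%:M : 'M[C]_n)) = rowsub f 1%:M.
  by apply/matrixP => i j; rewrite !mxE rmorph_nat eq_sym.
by rewrite -(rowsubE f A) -mxsubcr.
Qed.

End Psd.

(** * Strict separation of a point from a compact convex set *)

Section Separation.
Variables (R : realType) (m : nat).
Implicit Types u v w x : 'rV[R]_m.

Definition dotr u v : R := \sum_j u 0 j * v 0 j.

Lemma dotrC u v : dotr u v = dotr v u.
Proof. by apply: eq_bigr => j _; rewrite mulrC. Qed.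

Lemma dotrDr u v w : dotr u (v + w) = dotr u v + dotr u w.
Proof. by rewrite -big_split; apply: eq_bigr => j _; rewrite mxE mulrDr. Qed.

Lemma dotrZr a u v : dotr u (a *: v) = a * dotr u v.
Proof. by rewrite big_distrr; apply: eq_bigr => j _; rewrite mxE mulrCA. Qed.

Lemma dotrDl u v w : dotr (u + v) w = dotr u w + dotr v w.
Proof. by rewrite dotrC dotrDr !(dotrC w). Qed.

Lemma dotrZl a u v : dotr (a *: u) v = a * dotr u v.
Proof. by rewrite dotrC dotrZr dotrC. Qed.

Lemma dotr_line u v t :
  dotr (u + t *: v) (u + t *: v) =
  dotr u u + 2 * t * dotr u v + t ^+ 2 * dotr v v.
Proof. by rewrite !(dotrDr, dotrDl, dotrZl, dotrZr) (dotrC v u); ring. Qed.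

Lemma dotr_ge0 u : 0 <= dotr u u.
Proof. by apply: sumr_ge0 => j _; rewrite -expr2 sqr_ge0. Qed.

Lemma dotr_eq0 u : dotr u u = 0 -> u = 0.
Proof.
move=> /eqP; rewrite psumr_eq0 => [/allP u0|j _]; last first.
  by rewrite -expr2 sqr_ge0.
apply/rowP => j; rewrite mxE; apply/eqP.
by have := u0 j (mem_index_enum j); rewrite mulf_eq0 orbb.
Qed.

Lemma sum_continuous (T : topologicalType) (I : finType) (f : I -> T -> R) :
  (forall i, continuous (f i)) -> continuous (fun t => \sum_i f i t).
Proof.
move=> cf; apply: continuous_big => // z.
by apply: cvgD; [exact: cvg_fst | exact: cvg_snd].
Qed.

Lemma additive_homogeneous_continuous (f : 'rV[R]_m -> R) :
  {morph f : u v / u + v} -> (forall a u, f (a *: u) = a * f u) -> continuous f.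
Proof.
move=> fD fZ.
have f0 : f 0 = 0 by rewrite -[0 in LHS](scale0r 0) fZ mul0r.
have -> : f = fun v => \sum_j v 0 j * f (delta_mx 0 j).
  apply/funext => v; rewrite {1}(row_sum_delta v) (big_morph f fD f0).
  by apply: eq_bigr => j _; rewrite fZ.
apply: sum_continuous => j v.
exact: cvgM (@coord_continuous _ _ _ 0 j v) (cvg_cst _).
Qed.

(** The normal is [c - r], where [c] is the point of [D] nearest to [r], and the margin is the
    squared distance. A point of [D] on the wrong side of the hyperplane through [c] would allow a
    move from [c] towards it that comes closer to [r]. *)
Lemma compact_convex_separation (D : set 'rV[R]_m) r :
  D !=set0 -> compact D ->
  (forall x y, D x -> D y ->
    forall t : R, 0 <= t <= 1 -> D (t *: x + (1 - t) *: y)) ->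
  ~ D r ->
  exists w (d : R), 0 < d /\ forall x, D x -> dotr w r + d <= dotr w x.
Proof.
move=> D0 cD vD Dr.
pose f x := dotr (x - r) (x - r).
have cf : continuous f.
  apply: sum_continuous => j x.
  have cj : continuous (fun v : 'rV[R]_m => (v - r) 0 j).
    rewrite (_ : (fun v => _) = (fun v : 'rV[R]_m => v 0 j) \- cst (r 0 j)).
      by move=> y; exact: cvgB (@coord_continuous _ _ _ 0 j y) (cvg_cst _).
    by apply/funext => v; rewrite !mxE.
  exact: cvgM (cj x) (cj x).
have [c /set_mem cinD fmin] := EVT_min_rV D0 cD (continuous_subspaceT cf).
pose w := c - r.
have w0 : 0 < dotr w w.
  rewrite lt_neqAle dotr_ge0 andbT; apply/eqP => /esym/dotr_eq0/subr0_eq cr.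
  by apply: Dr; rewrite -cr.
exists w, (dotr w w); split=> // x Dx.
have -> : dotr w r + dotr w w = dotr w c.
  by rewrite -dotrDr /w [r + _]addrC subrK.
have xE : x = c + (x - c) by rewrite [RHS]addrC subrK.
set z := x - c in xE; rewrite xE dotrDr lerDl leNgt; apply/negP => p_lt0.
set p := dotr w z in p_lt0; set q := dotr z z.
have ineq t : 0 <= t <= 1 -> 0 <= 2 * t * p + t ^+ 2 * q.
  move=> t01; have /mem_set/fmin := vD _ _ Dx cinD t t01.
  have -> : f (t *: x + (1 - t) *: c) = f c + (2 * t * p + t ^+ 2 * q).
    rewrite /f; have -> : t *: x + (1 - t) *: c - r = w + t *: z.
      by apply/rowP => j; rewrite /w /z !mxE; ring.
    by rewrite dotr_line -addrA.
  by rewrite lerDl.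
have q_ge0 : 0 <= q by exact: dotr_ge0.
(* The quadratic in [t] is least at [- p / q]. If this is not below 1, or if [q = 0], then [t = 1]
   already gives [2 * p + q <= p < 0]. *)
have [qp|pq] := lerP q (- p).
  by have := ineq 1; rewrite ler01 lexx => /(_ isT); lra.
have q_gt0 : 0 < q by lra.
have t01 : 0 <= - p / q <= 1.
  by rewrite ler_pdivrMr // divr_ge0 //= ?mul1r ?oppr_ge0 ltW.
have := ineq _ t01.
have -> : 2 * (- p / q) * p + (- p / q) ^+ 2 * q = - (p ^+ 2 / q).
  by field; rewrite gt_eqF.
by rewrite oppr_ge0 leNgt divr_gt0 // exprn_even_gt0 //= lt_eqF.
Qed.

End Separation.

(** * Real coordinates on the space of hermitian matrices *)

Section HermitianCoordinates.
Variables (R : realType) (n : nat).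
Local Notation C := R[i].
Local Notation V := 'rV[R]_(n * n).

(* Real coordinates of hermitian matrices: a real matrix S encodes
   (S + S^T) + i (S - S^T); the trace form becomes 4 times the dot product. *)
Definition herm_of (v : V) : 'M[C]_n := let S := vec_mx v in
  \matrix_(i, j) ((S i j + S j i) +i* (S i j - S j i))%C.

(** For hermitian [A] the real parts form a symmetric matrix and the imaginary parts an
    antisymmetric one, so their sum determines both. *)
Definition herm_coord (A : 'M[C]_n) : V :=
  mxvec (\matrix_(i, j) ((complex.Re (A i j) + complex.Im (A i j)) / 2)).

Lemma herm_ofE (v : V) i j :
  herm_of v i j =
  ((vec_mx v i j + vec_mx v j i) +i* (vec_mx v i j - vec_mx v j i))%C.
Proof. by rewrite /herm_of mxE. Qed.

Lemma herm_of_adj v : herm_of v = adjmx (herm_of v).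
Proof.
apply/matrixP => i j; rewrite adjmxE !herm_ofE; apply/eqP.
by rewrite eq_complex /= addrC opprB !eqxx.
Qed.

Lemma herm_coordK A : A = adjmx A -> herm_of (herm_coord A) = A.
Proof.
move=> hA; apply/matrixP => i j; rewrite herm_ofE /herm_coord mxvecK !mxE.
have -> : A j i = Num.conj (A i j) by rewrite -adjmxE -hA.
rewrite complexRe_conj complexIm_conj; case: (A i j) => a b /=.
by apply/eqP; rewrite eq_complex /=; apply/andP; split; apply/eqP; field.
Qed.

Lemma herm_ofD u v : herm_of (u + v) = herm_of u + herm_of v.
Proof.
apply/matrixP => i j; rewrite [RHS]mxE !herm_ofE linearD /= !mxE.
by apply/eqP; rewrite eq_complex /=; apply/andP; split; apply/eqP; ring.
Qed.

Lemma herm_ofZ a v : herm_of (a *: v) = a%:C%C *: herm_of v.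
Proof.
apply/matrixP => i j; rewrite [RHS]mxE !herm_ofE linearZ /= !mxE.
by apply/eqP; rewrite eq_complex /=; apply/andP; split; apply/eqP; ring.
Qed.

Lemma Re_sum (I : finType) (F : I -> C) :
  complex.Re (\sum_i F i) = \sum_i complex.Re (F i).
Proof.
by rewrite (big_morph (@complex.Re R) (id1 := 0) (op1 := +%R)) // => -[? ?] [].
Qed.

Lemma dotr_vec_mx (u v : V) :
  dotr u v = \sum_i \sum_j vec_mx u i j * vec_mx v i j.
Proof.
rewrite pair_big /= /dotr (reindex _ (curry_mxvec_bij _ _)) /=.
by apply: eq_bigr => -[i j] _ /=; rewrite !mxE.
Qed.

(** In the real part of each product of entries the mixed terms cancel, leaving twice the [(i, j)]
    product plus twice the [(j, i)] product. Exchanging the two sums makes both halves equal. *)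
Lemma mxtrace_herm_of u v :
  complex.Re (\tr (herm_of u *m herm_of v)) = 4 * dotr u v.
Proof.
set S := vec_mx u; set T := vec_mx v.
have -> : complex.Re (\tr (herm_of u *m herm_of v)) =
    \sum_i \sum_j (2 * (S i j * T i j) + 2 * (S j i * T j i)).
  rewrite /mxtrace Re_sum; apply: eq_bigr => i _; rewrite mxE Re_sum.
  apply: eq_bigr => j _; rewrite !herm_ofE /= -/S -/T; ring.
have -> : 4 * dotr u v = 2 * dotr u v + 2 * dotr u v by ring.
rewrite dotr_vec_mx [X in _ + 2 * X]exchange_big /= !big_distrr -big_split.
apply: eq_bigr => i _; rewrite !big_distrr -big_split.
by apply: eq_bigr => j _.
Qed.

Lemma normC_le (a b : R) : `|(a +i* b)%C : C| <= (`|a| + `|b|)%:C%C.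
Proof.
rewrite normc_def lecR /=.
have -> : `|a| + `|b| = Num.sqrt ((`|a| + `|b|) ^+ 2).
  by rewrite sqrtr_sqr [RHS]ger0_norm // addr_ge0.
rewrite ler_wsqrtr // sqrrD !real_normK ?num_real //.
have := mulr_ge0 (normr_ge0 a) (normr_ge0 b); lra.
Qed.

Lemma herm_of_continuous : continuous (herm_of : V -> 'M[C^o]_n).
Proof.
move=> v U /= /nbhs_ballP[e e0 eU].
(* The radius [e] is a complex number; being positive, it is real. *)
have eE : e = (complex.Re e)%:C%C.
  move: e0; rewrite /= ltcE /= => /andP[/eqP ei _].
  by rewrite [LHS]complexE ei mulr0 addr0.
set d := complex.Re e in eE.
have d0 : 0 < d by move: e0; rewrite /= eE ltcR.
(* The real and the imaginary part of an entry each combine two coordinates, so the entry moves by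
   less than [4 * d / 5]. *)
apply/nbhs_ballP; exists (d / 5) => /=; first by rewrite divr_gt0.
move=> u [_ uv]; apply: eU; split=> // i j.
rewrite -ball_normE /= !herm_ofE.
have k a b : `|vec_mx v a b - vec_mx u a b| < d / 5.
  by rewrite !mxE; have := uv 0 (mxvec_index a b); rewrite -ball_normE.
rewrite [X in `|X|](_ : _ =
    (((vec_mx v i j - vec_mx u i j) + (vec_mx v j i - vec_mx u j i)) +i*
     ((vec_mx v i j - vec_mx u i j) - (vec_mx v j i - vec_mx u j i)))%C);
  last first.
  by apply/eqP; rewrite eq_complex /=; apply/andP; split; apply/eqP; ring.
apply: le_lt_trans (normC_le _ _) _; rewrite eE ltcR.
have := ler_normD (vec_mx v i j - vec_mx u i j) (vec_mx v j i - vec_mx u j i).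
have := ler_normB (vec_mx v i j - vec_mx u i j) (vec_mx v j i - vec_mx u j i).
have := k i j; have := k j i; lra.
Qed.

End HermitianCoordinates.

(** * Compactness of the set of states *)

Section Density.
Variables (R : realType) (n : nat).
Local Notation C := R[i].
Local Notation V := 'rV[R]_(n * n).

Lemma herm_of_trace_continuous (B : 'M[C]_n) :
  continuous (fun v : V => complex.Re (\tr (herm_of v *m B))).
Proof.
apply: additive_homogeneous_continuous => [u v|a u].
  rewrite herm_ofD mulmxDl linearD /=.
  by case: (\tr _) => ? ?; case: (\tr _).
rewrite herm_ofZ -scalemxAl linearZ /=.
by case: (\tr _) => x y /=; rewrite mul0r subr0.
Qed.

(** The trace of a hermitian matrix is real, so real parts suffice. All conditions have the form of
    a trace against a fixed matrix, the identity included, so that [herm_of_trace_continuous] covers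
    each of them. *)
Lemma density_herm_ofP (v : V) : density (herm_of v) <->
  (forall x : 'cV[C]_n,
     0 <= complex.Re (\tr (herm_of v *m (x *m adjmx x)))) /\
  complex.Re (\tr (herm_of v *m 1%:M)) = 1.
Proof.
have h := herm_of_adj v; rewrite mulmx1; split=> [[/psdP[_ q] ->]|[q t1]].
  by split.
split; first by apply/psdP.
apply/eqP; rewrite eq_complex t1 eqxx /=.
have := congr1 (@complex.Im R) (mxtrace_adj (herm_of v)).
by rewrite -h complexIm_conj => e; apply/eqP; lra.
Qed.

Lemma closed_density_coord : closed [set v : V | density (herm_of v)].
Proof.
have -> : [set v : V | density (herm_of v)] =
    (\bigcap_(x : 'cV[C]_n) [set v : V |
       0 <= complex.Re (\tr (herm_of v *m (x *m adjmx x)))]) `&`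
    [set v | complex.Re (\tr (herm_of v *m 1%:M)) = 1].
  apply/seteqP; split=> v /=.
    by move/density_herm_ofP => [q t1]; split=> // x _; exact: q.
  by move=> [q t1]; apply/density_herm_ofP; split=> // x; exact: q.
apply: closedI.
  apply: closed_bigI => x _.
  apply: (@closed_comp _ _
    (fun v : V => complex.Re (\tr (herm_of v *m (x *m adjmx x))))
    [set y | 0 <= y]); last exact: closed_ge.
  by move=> v _; exact: herm_of_trace_continuous.
apply: (@closed_comp _ _ (fun v : V => complex.Re (\tr (herm_of v *m 1%:M)))
    [set y | y = 1]); last exact: closed_eq.
by move=> v _; exact: herm_of_trace_continuous.
Qed.

(** For a state [A], positivity of [tr(A (1 - A))] gives [tr(A^2) <= 1], and [tr(A^2)] is
    [4 * dotr v v]. *)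
Lemma density_coord_bounded (v : V) : density (herm_of v) -> dotr v v <= 1.
Proof.
move=> [pv tv]; have := psd_mxtrace_mul pv (psd_mxtrace_sub pv).
rewrite tv mulmxBr mulmx1 linearB /= tv subr_ge0 lecE /= => /andP[_].
by rewrite mxtrace_herm_of; have := dotr_ge0 v; lra.
Qed.

Lemma compact_density_coord : compact [set v : V | density (herm_of v)].
Proof.
apply: bounded_closed_compact closed_density_coord.
exists 1; split=> // M M1 v /= /density_coord_bounded v1.
rewrite [leLHS]/Num.norm /= mx_normrE; apply/bigmax_leP; split=> [|[i j] _ /=].
  by rewrite ltW // (lt_trans ltr01).
rewrite ord1; apply: le_trans (ltW M1).
have : v 0 j * v 0 j <= 1.
  apply: le_trans v1; rewrite /dotr (bigD1 j) //= lerDl sumr_ge0 // => k _.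
  by rewrite -expr2 sqr_ge0.
by rewrite -expr2 -real_normK ?num_real // expr_le1.
Qed.

End Density.

(** * Channels, linearity and positivity of [p_err], and the ensemble of an effect *)

Section Channels.
Variable R : realType.
Local Notation C := R[i].

(** This is complete positivity at [k = 1]. The index types of sizes [1 * n] and [n] differ, so
    matrices are carried across by reindexing along [mxvec_index 0] and a left inverse of it. *)
Lemma channel_psd n m (L : 'M[C]_n -> 'M[C]_m) (A : 'M[C]_n) :
  channel L -> psd A -> psd (L A).
Proof.
move=> [_ cp _] pA.
have idxP k : exists f : 'I_(1 * k) -> 'I_k, cancel (mxvec_index 0) f.
  have [g gK _] := curry_mxvec_bij 1 k; exists (fun j => (g j).2) => a.
  by have /= -> := gK (0, a) isT.
have [f fK] := idxP n; have [h hK] := idxP m.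
have pY : psd (mxsub h h (L A)).
  apply: (cp 1%N (mxsub f f A)); first exact: psd_mxsub.
  move=> p q c d; rewrite !ord1 mxE !hK; congr (L _ c d).
  by apply/matrixP => a b; rewrite !mxE !fK.
rewrite (_ : L A = mxsub (mxvec_index 0) (mxvec_index 0) (mxsub h h (L A))).
  exact: psd_mxsub.
by apply/matrixP => a b; rewrite !mxE !hK.
Qed.

Lemma is_linear_mapD n m (L : 'M[C]_n -> 'M[C]_m) a b A B :
  is_linear_map L -> L (a *: A + b *: B) = a *: L A + b *: L B.
Proof.
move=> linL; have L0 : L 0 = 0.
  have := linL 1 0 0; rewrite scaler0 addr0 scale1r => /eqP.
  by rewrite -subr_eq0 opprD addNKr oppr_eq0 => /eqP.
by rewrite linL; have := linL b B 0; rewrite L0 !addr0 => ->.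
Qed.

Lemma p_errD n (A B : 'M[C]_n) (a b : R) (E : ens_povm R n) :
  valid_ens_povm E ->
  p_err (a%:C%C *: A + b%:C%C *: B) E = a * p_err A E + b * p_err B E.
Proof.
move=> [_ _ chE _ _]; rewrite /p_err !Re_sum !big_distrr -big_split.
apply: eq_bigr => i _ /=.
have [linL _ _] := chE i; rewrite (is_linear_mapD _ _ _ _ linL).
rewrite mulmxDr linearD -!scalemxAr !linearZ /=.
case: (\tr _) => x y; case: (\tr _) => z t /=; ring.
Qed.

Lemma p_err_ge0 n (A : 'M[C]_n) (E : ens_povm R n) :
  valid_ens_povm E -> psd A -> 0 <= p_err A E.
Proof.
move=> [p0 _ chE pM _] pA; rewrite /p_err Re_sum sumr_ge0 // => i _.
have : 0 <= (ep_p i)%:C%C * \tr (ep_M i *m ep_chan i A).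
  rewrite mulr_ge0 ?ler0c ?p0 //.
  by apply: psd_mxtrace_mul => //; exact: channel_psd.
by rewrite lecE => /andP[].
Qed.

Lemma id_channel n : channel (@id 'M[C]_n).
Proof.
split=> // k X pX Y YE; suff -> : Y = X by [].
apply/matrixP => i j; case/mxvec_indexP: i => p c; case/mxvec_indexP: j => q d.
by rewrite YE mxE.
Qed.

(* The second index has probability 0: it only completes W to a POVM. *)
Definition effect_ens n (W : 'M[C]_n) : ens_povm R n :=
  @EnsPovm R n 2 n (fun i => (i == 0)%:R) (fun=> id)
    (fun i => if i == 0 then W else 1%:M - W).

Lemma effect_ens_valid n (W : 'M[C]_n) :
  psd W -> psd (1%:M - W) -> valid_ens_povm (effect_ens W).
Proof.
move=> pW pW1; split=> [i||i|i|] /=; first exact: ler0n.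
- by rewrite big_ord_recl big_ord1 /= addr0.
- exact: id_channel.
- by case: (i == 0).
- by rewrite big_ord_recl big_ord1 /= addrC subrK.
Qed.

Lemma p_err_effect n (W A : 'M[C]_n) :
  p_err A (effect_ens W) = complex.Re (\tr (W *m A)).
Proof.
by rewrite /p_err big_ord_recl big_ord1 /= mul1r mul0r addr0.
Qed.

End Channels.

(** * Construction of an effect separating the state from the mixtures *)

Section Witness.
Variables (R : realType) (n : nat).
Local Notation C := R[i].
Local Notation V := 'rV[R]_(n * n).

Definition rtrace (W A : 'M[C]_n) : R := complex.Re (\tr (W *m A)).

Lemma rtraceBr W A c :
  \tr A = 1 -> rtrace (W - c%:C%C%:M) A = rtrace W A - c.
Proof.
move=> tA; rewrite /rtrace mulmxBl linearB /= mul_scalar_mx linearZ /= tA mulr1.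
by case: (\tr _).
Qed.

Lemma rtrace_comb W A B (a b : R) :
  rtrace W (a%:C%C *: A + b%:C%C *: B) = a * rtrace W A + b * rtrace W B.
Proof.
rewrite /rtrace mulmxDr linearD -!scalemxAr !linearZ /=.
by case: (\tr _) => x y; case: (\tr _) => z t /=; ring.
Qed.

Lemma rtraceZ a W A : rtrace (a%:C%C *: W) A = a * rtrace W A.
Proof.
rewrite /rtrace -scalemxAl linearZ /=.
by case: (\tr _) => x y /=; rewrite mul0r subr0.
Qed.

Lemma density_mix (A B : 'M[C]_n) (t : R) : 0 <= t <= 1 ->
  density A -> density B -> density (t%:C%C *: A + (1 - t)%:C%C *: B).
Proof.
move=> /andP[t0 t1] [pA tA] [pB tB]; split.
  by apply: psdD; apply: psdZ => //; rewrite subr_ge0.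
rewrite linearD !linearZ /= tA tB !mulr1.
by apply/eqP; rewrite eq_complex /=; apply/andP; split; apply/eqP; ring.
Qed.

(** The quadratic form at [x] pairs [W] with [x *m adjmx x], which is a nonnegative multiple of a
    state; if its trace, the squared norm of [x], vanishes, then [x = 0]. *)
Lemma psd_of_density_ge0 (W : 'M[C]_n) : W = adjmx W ->
  (forall A, density A -> 0 <= rtrace W A) -> psd W.
Proof.
move=> hW W0; apply/psdP; split=> // x.
set X := x *m adjmx x.
have pX : psd X by exact: psd_rank1.
have : 0 <= \tr X by have := psd_mxtrace_mul pX (psd1 R n); rewrite mulmx1.
rewrite lecE /= => /andP[/eqP tXi tX0]; set t := complex.Re (\tr X) in tX0.
have tE : \tr X = t%:C%C by apply/eqP; rewrite eq_complex /= tXi !eqxx.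
have [t0|t_neq0] := eqVneq t 0.
  suff -> : X = 0 by rewrite mulmx0 mxtrace0.
  have x0 : x = 0.
    apply/matrixP => i j; rewrite ord1 [RHS]mxE; apply/eqP.
    move: tE; rewrite t0 /X mxtrace_mulC /mxtrace big_ord1 mxE => /eqP.
    rewrite psumr_eq0 => [/allP/(_ i (mem_index_enum i))|k _].
      by rewrite adjmxE mulf_eq0 conjC_eq0 orbb.
    by rewrite adjmxE mulrC mul_conjC_ge0.
  by rewrite /X x0 mul0mx.
have t_gt0 : 0 < t by rewrite lt_neqAle eq_sym t_neq0.
have dX : density ((t^-1)%:C%C *: X).
  split; first by apply: psdZ; rewrite ?invr_ge0.
  by rewrite linearZ /= tE -rmorphM /= mulVf.
have := W0 _ dX; rewrite /rtrace -scalemxAr linearZ /=.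
case: (\tr _) => a b /=; rewrite mul0r subr0 pmulr_rge0 ?invr_gt0 //.
Qed.

Lemma weight_witness (F : set 'M[C]_n) (rho : 'M[C]_n) (l : R) :
  F `<=` density (R := R) (n := n) -> F !=set0 ->
  closed (F : set 'M[C^o]_n) -> real_convex F -> density rho -> 0 < l < 1 ->
  (forall sigma tau, F sigma -> density tau ->
     rho <> l%:C%C *: sigma + (1 - l)%:C%C *: tau) ->
  exists (W : 'M[C]_n) (d : R), [/\ psd W, psd (1%:M - W), 0 < d &
    forall sigma, F sigma -> rtrace W rho + d <= l * rtrace W sigma].
Proof.
move=> Fdens [s0 Fs0] Fcl Fcvx drho /andP[l0 l1] rhoN.
have l1' : 0 < 1 - l by rewrite subr_gt0.
have herm A : density A -> A = adjmx A by case=> -[].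
pose KF := [set v : V | F (herm_of v)].
pose T := [set v : V | density (herm_of v)].
have cKF : compact KF.
  apply: (subclosed_compact _ (@compact_density_coord R n)); last first.
    by move=> v; exact: Fdens.
  apply: (@closed_comp V 'M[C^o]_n (@herm_of R n) F _ Fcl) => v _.
  exact: herm_of_continuous.
pose mix (p : V * V) := l *: p.1 + (1 - l) *: p.2.
have mixE p : herm_of (mix p) =
    l%:C%C *: herm_of p.1 + (1 - l)%:C%C *: herm_of p.2.
  by rewrite herm_ofD !herm_ofZ.
have cmix : continuous mix.
  by move=> p; apply: cvgD; apply: cvgZl_tmp; [exact: cvg_fst|exact: cvg_snd].
(* The coordinates of all mixtures: a continuous image of a product of two compact convex sets. *)
pose D := mix @` (KF `*` T).
have D0 : D !=set0.
  exists (mix (herm_coord s0, herm_coord s0)).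
  exists (herm_coord s0, herm_coord s0) => //.
  by split; rewrite /= /KF /T /= herm_coordK; auto.
have cD : compact D.
  apply: continuous_compact; first exact: continuous_subspaceT.
  by apply: compact_setX => //; exact: compact_density_coord.
have vD x y : D x -> D y ->
    forall t : R, 0 <= t <= 1 -> D (t *: x + (1 - t) *: y).
  move=> [p [Fp Tp] <-] [q [Fq Tq] <-] t t01.
  exists (t *: p.1 + (1 - t) *: q.1, t *: p.2 + (1 - t) *: q.2).
    split; rewrite /= /KF /T /= herm_ofD !herm_ofZ; first exact: Fcvx.
    exact: density_mix.
  by apply/rowP => j; rewrite /mix !mxE; ring.
have rhoD : ~ D (herm_coord rho).
  move=> [p [Fp Tp]] /(congr1 (@herm_of R n)).
  by rewrite mixE herm_coordK; [move/esym; exact: rhoN | exact: herm].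
have [w [d [d0 sep]]] := compact_convex_separation D0 cD vD rhoD.
pose W0 := herm_of w.
(* The factor 4 converts dot products of coordinates into traces. *)
have sepW s t : F s -> density t ->
    rtrace W0 rho + 4 * d <= l * rtrace W0 s + (1 - l) * rtrace W0 t.
  move=> Fs dt.
  have Dst : D (mix (herm_coord s, herm_coord t)).
    exists (herm_coord s, herm_coord t) => //.
    by split; rewrite /= /KF /T /= herm_coordK; auto.
  have := sep _ Dst.
  rewrite -(@ler_pM2l _ 4) // mulrDr -!mxtrace_herm_of mixE /=.
  rewrite !herm_coordK; auto.
  by rewrite -!/(rtrace _ _) rtrace_comb.
(* Solving [sepW] for [rtrace W0 t] bounds [S] below, so its infimum [c] exists; [le_c] then puts
   [c] in place of [rtrace W0 t]. *)
pose S := [set rtrace W0 t | t in density (R := R) (n := n)].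
have lbS s : F s ->
    lbound S ((rtrace W0 rho + 4 * d - l * rtrace W0 s) / (1 - l)).
  move=> Fs _ [t dt <-]; rewrite ler_pdivrMr // mulrC.
  by have := sepW s t Fs dt; lra.
have S0 : S !=set0 by exists (rtrace W0 rho), rho.
pose c := inf S.
have c_le t : density t -> c <= rtrace W0 t.
  move=> dt; apply: ge_inf; last by exists t.
  by eexists; exact: lbS Fs0.
have le_c s : F s -> rtrace W0 rho + 4 * d - l * rtrace W0 s <= (1 - l) * c.
  move=> Fs; rewrite [leRHS]mulrC -ler_pdivrMr //.
  by apply: lb_le_inf => //; exact: lbS.
pose W1 := W0 - c%:C%C%:M.
have W1E t : density t -> rtrace W1 t = rtrace W0 t - c.
  by move=> [_ tt]; exact: rtraceBr.
have pW1 : psd W1.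
  apply: psd_of_density_ge0 => [|t dt]; last by rewrite W1E // subr_ge0 c_le.
  apply/matrixP => i j; rewrite adjmxE !(mxE, herm_ofE) [j == i]eq_sym.
  apply/eqP; rewrite eq_complex.
  by case: (i == j) => /=; apply/andP; split; apply/eqP; ring.
have : 0 <= \tr W1 by have := psd_mxtrace_mul pW1 (psd1 R n); rewrite mulmx1.
rewrite lecE /= => /andP[/eqP ti t0]; set tr1 := complex.Re _ in t0.
have trE : \tr W1 = tr1%:C%C by apply/eqP; rewrite eq_complex /= ti !eqxx.
(* The trace of [W1] dominates [W1]; adding 1 keeps the scaling factor invertible even if
   [W1 = 0]. *)
pose a := tr1 + 1.
have a0 : 0 < a by rewrite ltr_wpDl.
exists ((a^-1)%:C%C *: W1), (a^-1 * (4 * d)); split.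
- by apply: psdZ; rewrite // invr_ge0 ltW.
- have -> : 1%:M - (a^-1)%:C%C *: W1 =
      (a^-1)%:C%C *: (((\tr W1)%:M - W1) + 1%:M).
    have -> : ((\tr W1)%:M - W1) + 1%:M = a%:C%C%:M - W1 :> 'M[C]_n.
      by rewrite trE addrAC -raddfD /a rmorphD rmorph1.
    have aV : (a^-1)%:C%C * a%:C%C = 1 :> C.
      by rewrite -rmorphM /= mulVf // gt_eqF.
    by rewrite [RHS]scalerBr scale_scalar_mx aV.
  apply: psdZ; first by rewrite invr_ge0 ltW.
  by apply: psdD; [exact: psd_mxtrace_sub | exact: psd1].
- by rewrite mulr_gt0 ?invr_gt0 // mulr_gt0.
(* The shift changes the two sides by [- c] and [- l * c]; the discrepancy [(1 - l) * c] is the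
   right side of [le_c]. *)
move=> s Fs; rewrite !rtraceZ -mulrDr mulrCA ler_pM2l ?invr_gt0 //.
by rewrite !W1E //; [have := le_c s Fs; lra | exact: Fdens].
Qed.

End Witness.

(** * The minimal ratio for a single closed convex set *)

Section Weight.
Variables (R : realType) (n : nat).
Local Notation C := R[i].
Implicit Types (F : set 'M[C]_n) (rho : 'M[C]_n).

Definition weights F rho := [set s : R | 0 <= s /\ exists sigma tau,
  [/\ F sigma, density tau & rho = s%:C%C *: tau + (1 - s)%:C%C *: sigma]].

Lemma WoRE F rho : WoR F rho = inf (weights F rho).
Proof. by []. Qed.

Lemma weights_lb F rho : lbound (weights F rho) 0.
Proof. by move=> s []. Qed.

(** Take [tau = rho]. This makes the infimum defining [WoR] one over a nonempty set and bounds it by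
    1. *)
Lemma weights1 F rho : F !=set0 -> density rho -> weights F rho 1.
Proof.
move=> [s Fs] drho; split=> //; exists s, rho; split=> //.
by rewrite subrr scale1r scale0r addr0.
Qed.

Section OneSet.
Variables (F : set 'M[C]_n) (rho : 'M[C]_n).
Hypotheses (Fdens : F `<=` density (R := R) (n := n)) (F0 : F !=set0).
Hypothesis drho : density rho.

Lemma rtrace1 A : density A -> rtrace (1%:M : 'M[C]_n) A = 1.
Proof. by move=> [_ tA]; rewrite /rtrace mul1mx tA. Qed.

Lemma free_perr_le E sigma : valid_ens_povm E -> F sigma ->
  free_perr F E <= p_err sigma E.
Proof.
move=> vE Fs; apply: ge_inf; last by exists sigma.
by exists 0 => _ [s /Fdens[ps _] <-]; exact: p_err_ge0.
Qed.

Lemma le_free_perr E b : (forall sigma, F sigma -> b <= p_err sigma E) ->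
  b <= free_perr F E.
Proof.
move=> hb; apply: lb_le_inf; last by move=> _ [s Fs <-]; exact: hb.
by have [s Fs] := F0; exists (p_err s E), s.
Qed.

Let ratios := [set r : R | exists E : ens_povm R n,
  [/\ valid_ens_povm E, 0 < free_perr F E & r = p_err rho E / free_perr F E]].

Lemma ratios_lb : lbound ratios 0.
Proof.
move=> _ [E [vE f0 ->]]; apply: divr_ge0; last exact: ltW.
by apply: p_err_ge0 => //; case: drho.
Qed.

(** The trivial effect [1%:M] gives [p_err] equal to 1 on every state. *)
Lemma min_ratio_le1 : min_ratio F rho <= 1 /\ ratios !=set0.
Proof.
have v1 : valid_ens_povm (effect_ens (1%:M : 'M[C]_n)).
  apply: effect_ens_valid; first exact: psd1.
  rewrite subrr -(scale0r (1%:M : 'M[C]_n)); apply: psdZ => //; exact: psd1.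
have f1 : 1 <= free_perr F (effect_ens (1%:M : 'M[C]_n)).
  apply: le_free_perr => s /Fdens ds.
  by rewrite p_err_effect -/(rtrace _ _) rtrace1.
have r1 : ratios (1 / free_perr F (effect_ens (1%:M : 'M[C]_n))).
  exists (effect_ens 1%:M); split=> //; first exact: lt_le_trans f1.
  by rewrite p_err_effect -/(rtrace _ _) rtrace1.
split; last by eexists; exact: r1.
apply: le_trans (ge_inf _ r1) _; first by exists 0; exact: ratios_lb.
by rewrite ler_pdivrMr ?mul1r // (lt_le_trans ltr01).
Qed.

Lemma min_ratio_ge s : weights F rho s -> 1 - s <= min_ratio F rho.
Proof.
move=> [s0 [sigma [tau [Fs dt rhoE]]]].
have [_ rn0] := min_ratio_le1.
apply: lb_le_inf => // r rr.
have [s1|s1] := lerP s 1; last first.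
  by apply: le_trans (ratios_lb rr); rewrite subr_le0 ltW.
move: rr => [E [vE f0 ->]]; rewrite ler_pdivlMr //.
rewrite rhoE p_errD //.
apply: (@le_trans _ _ ((1 - s) * p_err sigma E)).
  by rewrite ler_wpM2l ?subr_ge0 // free_perr_le.
by rewrite lerDr mulr_ge0 // p_err_ge0 //; case: dt.
Qed.

Hypotheses (Fcl : closed (F : set 'M[C^o]_n)) (Fcvx : real_convex F).

Lemma min_ratioE : min_ratio F rho = 1 - WoR F rho.
Proof.
have w1 := weights1 F0 drho.
have wlb : has_lbound (weights F rho) by exists 0; exact: weights_lb.
apply/eqP; rewrite eq_le; apply/andP; split; last first.
  rewrite lerBlDr -lerBlDl; apply: lb_le_inf; first by exists 1.
  by move=> s /min_ratio_ge; lra.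
rewrite leNgt; apply/negP => lt_r.
have W1 : WoR F rho <= 1 by exact: ge_inf.
(* The midpoint of the supposed gap; it lies strictly between 0 and 1 since [WoR F rho] and
   [min_ratio F rho] are both at most 1. *)
pose l := ((1 - WoR F rho) + min_ratio F rho) / 2.
have [r1 _] := min_ratio_le1.
have l01 : 0 < l < 1 by rewrite /l; apply/andP; split; lra.
have lW : 1 - WoR F rho < l by rewrite /l; lra.
have lr : l < min_ratio F rho by rewrite /l; lra.
have [l0 l1] := andP l01.
(* A mixture equal to [rho] would make [1 - l] a weight, although it is smaller than [WoR F rho]. *)
have [|W [d [pW pW1 d0 hW]]] := weight_witness Fdens F0 Fcl Fcvx drho l01.
  move=> sigma tau Fs dt rhoE.
  suff : WoR F rho <= 1 - l by lra.
  rewrite WoRE; apply: ge_inf => //; split; first by lra.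
  by exists sigma, tau; split=> //; rewrite subKr addrC.
have vE := effect_ens_valid pW pW1; set E := effect_ens W in vE.
have rho0 : 0 <= rtrace W rho.
  by have := p_err_ge0 vE (proj1 drho); rewrite p_err_effect.
have fE : (rtrace W rho + d) / l <= free_perr F E.
  apply: le_free_perr => s Fs; rewrite p_err_effect -/(rtrace _ _).
  by rewrite ler_pdivrMr // mulrC; exact: hW.
(* The margin [d] keeps the denominator positive even when [rtrace W rho = 0]. *)
have f0 : 0 < free_perr F E.
  by apply: lt_le_trans fE; rewrite divr_gt0 // ltr_wpDl.
have : min_ratio F rho <= rtrace W rho / free_perr F E.
  apply: ge_inf; first by exists 0; exact: ratios_lb.
  by exists E; split=> //; rewrite p_err_effect.
rewrite ler_pdivlMr // leNgt => /negP; apply.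
have : l * free_perr F E < min_ratio F rho * free_perr F E by rewrite ltr_pM2r.
by apply: lt_trans; move: fE; rewrite ler_pdivrMr // mulrC; lra.
Qed.

End OneSet.
End Weight.

(** * Passage to the union of the convex sets *)

Unset Implicit Arguments.

Theorem theorem12 (R : realType) (n : nat) (K : Type) (F : K -> set 'M[R[i]]_n) :
  inhabited K ->
  (forall k, F k `<=` density (R := R) (n := n)) ->
  (forall k, F k !=set0) ->
  (forall k, closed (F k : set 'M[R[i]^o]_n)) ->
  (forall k, real_convex (F k)) ->
  closed (\bigcup_k F k : set 'M[R[i]^o]_n) ->
  forall rho : 'M[R[i]]_n, density rho -> ~ (\bigcup_k F k) rho ->
  1 - sup [set min_ratio (F k) rho | k in [set: K]] = WoR (\bigcup_k F k) rho.
Proof.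
move=> [k0] Fdens F0 Fcl Fcvx _ rho drho _.
have weights0 k : weights (F k) rho !=set0.
  by exists 1; exact: weights1.
set U := \bigcup_k F k; set S := [set _ | _ in _].
have ratioE k : min_ratio (F k) rho = 1 - WoR (F k) rho by exact: min_ratioE.
have sub k : weights (F k) rho `<=` weights U rho.
  move=> s [s0 [sigma [tau [Fs dt e]]]]; split=> //.
  by exists sigma, tau; split=> //; exists k.
(* Enlarging the free set only adds decompositions, so the weight over [U] is at most that over each
   [F k]. *)
have S_ub : ubound S (1 - WoR U rho).
  move=> _ [k _ <-]; rewrite ratioE lerD2l lerN2 !WoRE.
  apply: lb_le_inf => // s /sub; apply: ge_inf.
  by exists 0; exact: weights_lb.
apply/eqP; rewrite eq_le; apply/andP; split.
  rewrite [leRHS]WoRE; apply: lb_le_inf.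
    by have [s /sub ?] := weights0 k0; exists s.
  (* The free part of a decomposition over [U] lies in one [F k], so [s] is already a weight for
     that [k]. *)
  move=> s [s0 [sigma [tau [[k _ Fs] dt e]]]].
  have : 1 - s <= min_ratio (F k) rho.
    rewrite ratioE lerD2l lerN2 WoRE; apply: ge_inf.
      by exists 0; exact: weights_lb.
    by split=> //; exists sigma, tau.
  have : min_ratio (F k) rho <= sup S.
    by apply: ub_le_sup; [exists (1 - WoR U rho) | exists k].
  lra.
rewrite lerBrDl -lerBrDr; apply: ge_sup => //.
by exists (min_ratio (F k0) rho), k0.
Qed.
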